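(* Let $\pi\in\mathbb{R}^n\setminus\{0\}$, $\pi_0<\pi_1$ real, and $F=\{(x,t)\in\mathbb{R}^{n+1}: \pi_0\le\pi^Tx\le\pi_1\}$. Let $g:\mathbb{R}^n\to\mathbb{R}$ and $f:\mathbb{R}\to\mathbb{R}$ be closed convex functions, and let $$S_{g,f}=\{(x,t)\in\mathbb{R}^{n+1}: g(P_\pi^\perp x)+f(\pi^Tx)\le t\},$$ $a=\frac{f(\pi_1)-f(\pi_0)}{\pi_1-\pi_0}$ and $b=\frac{\pi_1f(\pi_0)-\pi_0f(\pi_1)}{\pi_1-\pi_0}$. Then $$\mathrm{conv}\bigl(S_{g,f}\setminus \mathrm{int}(F)\bigr)=S_{g,f}\cap C,\qquad C=\{(x,t)\in\mathbb{R}^{n+1}: g(P_\pi^\perp x)+a\,\pi^Tx+b\le t\}.$$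
   Context: $P_\pi^\perp=I-\frac{\pi\pi^T}{\|\pi\|_2^2}$ is the orthogonal projection onto the orthogonal complement of $\pi$. $\mathrm{int}$ is the topological interior and $\mathrm{conv}$ the convex hull. *)

(* Defs.v *)
From HB Require Import structures.
From mathcomp Require Import all_boot all_order all_algebra.
From mathcomp Require Import all_classical all_reals all_analysis.

Set Implicit Arguments.
Unset Strict Implicit.
Unset Printing Implicit Defensive.

Import Order.TTheory GRing.Theory Num.Theory.
Import numFieldNormedType.Exports.

Local Open Scope classical_set_scope.
Local Open Scope ring_scope.

Definition dotp (R : realType) (n : nat) (u v : 'cV[R]_n) : R :=
  (u^T *m v) 0 0.

(* The library norm on matrices is the sup norm. *)
Definition norm2 (R : realType) (n : nat) (u : 'cV[R]_n) : R :=
  Num.sqrt (\sum_(i < n) u i 0 ^+ 2).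

Definition proj_orth (R : realType) (n : nat) (u : 'cV[R]_n) : 'M[R]_n :=
  1%:M - (norm2 u ^+ 2)^-1 *: (u *m u^T).

Definition convex_hull (R : realType) (E : lmodType R) (A : set E) : set E :=
  smallest (@convex_set R E) A.

Definition epigraph (R : realType) (T : Type) (h : T -> R) : set (T * R) :=
  [set p | h p.1 <= p.2].

(* Closed in the sense of convex analysis: the epigraph is closed. *)
Definition closed_function (R : realType) (T : topologicalType)
    (h : T -> R) : Prop :=
  closed (epigraph h : set (T * R^o)%type).

(* R^(n+1) is modelled as the product of R^n and R; its topology is the
   product topology, i.e. the usual one. *)
Definition split_set (R : realType) (n : nat) (u : 'cV[R]_n) (u0 u1 : R) :
    set ('cV[R]_n * R^o)%type :=
  [set p | u0 <= dotp u p.1 <= u1].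

Definition split_epi (R : realType) (n : nat) (u : 'cV[R]_n)
    (g : 'cV[R]_n -> R) (f : R -> R) : set ('cV[R]_n * R^o)%type :=
  [set p | g (proj_orth u *m p.1) + f (dotp u p.1) <= p.2].

Definition split_cut (R : realType) (n : nat) (u : 'cV[R]_n)
    (g : 'cV[R]_n -> R) (a b : R) : set ('cV[R]_n * R^o)%type :=
  [set p | g (proj_orth u *m p.1) + a * dotp u p.1 + b <= p.2].

(* Main.v *)
(* Both sets only see [x] through [P x] and [s = pi^T x].  Outside the open slab
   [pi0 < s < pi1], which is the interior of [F], convexity puts the secant
   [a s + b] of [f] below [f], so the convex set [S `&` C] contains [S `\` F°].
   Conversely, a point of [S `&` C] inside the slab lies on the segment in the
   direction [(pi, a |pi|^2)] that joins the faces [s = pi0] and [s = pi1];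
   this direction fixes [P x] and follows the secant, and on the faces [f]
   agrees with its secant, so [C] gives membership in [S]. *)
Require Import Defs.
From HB Require Import structures.
From mathcomp Require Import all_boot all_order all_algebra.
From mathcomp Require Import all_classical all_reals all_analysis.
From mathcomp Require Import ring lra.

Import Order.TTheory GRing.Theory Num.Theory.
Import numFieldNormedType.Exports.

Local Open Scope classical_set_scope.
Local Open Scope ring_scope.

Lemma convex_functionP {R : realType} {E : lmodType R} (h : E -> R) :
  convex_function [set: E] h <->
  forall (k : R) (x y : E), 0 <= k <= 1 ->
    h (k *: x + (1 - k) *: y) <= k * h x + (1 - k) * h y.
Proof.
split=> [hc k x y /andP[k0 k1]|hc t x y _ _].
  by have /= := hc (Itv01 k0 k1) x y; apply; rewrite inE.
by apply: hc; rewrite ge0 le1.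
Qed.

Lemma convex_setP {R : realType} {E : lmodType R} (A : set E) :
  convex_set (A : set (convex_lmodType E)) <->
  forall (k : R) (x y : E), 0 <= k <= 1 -> A x -> A y ->
    A (k *: x + (1 - k) *: y).
Proof.
split=> [Ac k x y /andP[k0 k1] Ax Ay|Ac x y t].
  by have := Ac x y (Itv01 k0 k1); rewrite !inE; apply.
by rewrite !inE => Ax Ay; apply: Ac => //; rewrite ge0 le1.
Qed.

(** Convexity with its denominators cleared: the form stays meaningful when [x = z], and placing a
    face of the slab in the middle bounds the secant of [f] outside the slab. *)
Lemma convex_three_points {R : realType} {f : R -> R} (x y z : R) :
  convex_function [set: R^o] f -> x <= y <= z ->
  (z - x) * f y <= (z - y) * f x + (y - x) * f z.
Proof.
move=> /convex_functionP fc /andP[xy yz].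
have [xz|zx] := ltP x z; last first.
  have -> : y = x by apply: le_anti; lra.
  have -> : z = x by apply: le_anti; lra.
  lra.
have zx0 : 0 < z - x by lra.
have zxN0 : z - x != 0 by rewrite gt_eqF.
(* This weight is the one for which the combination of [x] and [z] equals [y]. *)
have := fc ((z - y) / (z - x)) x z.
have -> : (z - y) / (z - x) *: (x : R^o) + (1 - (z - y) / (z - x)) *: (z : R^o)
    = y by rewrite /GRing.scale/=; field.
rewrite divr_ge0 ?ler_pdivrMr ?mul1r; [|lra..].
have /[swap] /[apply] fy : true && (z - y <= z - x) by lra.
have -> : (z - y) * f x + (y - x) * f z =
  (z - x) * ((z - y) / (z - x) * f x + (1 - (z - y) / (z - x)) * f z) by field.
by rewrite ler_pM2l.
Qed.

Section split.
Context {R : realType} {n : nat}.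
Implicit Types (u x y : 'cV[R]_n).

Lemma dotpE u x : dotp u x = \sum_i u i 0 * x i 0.
Proof. by rewrite /dotp mxE; apply: eq_bigr => i _; rewrite mxE. Qed.

Lemma dotpDr u x y : dotp u (x + y) = dotp u x + dotp u y.
Proof. by rewrite /dotp mulmxDr mxE. Qed.

Lemma dotpZr u k x : dotp u (k *: x) = k * dotp u x.
Proof. by rewrite /dotp -scalemxAr mxE. Qed.

Lemma dotp_continuous u : continuous (dotp u).
Proof.
rewrite (_ : dotp u = fun y => \sum_i u i 0 * y i 0); last first.
  by apply/funext => y; rewrite dotpE.
apply: continuous_big => [|i _ y]; first exact: add_continuous.
have yi : (M : 'cV[R]_n) i 0 @[M --> y] --> y i 0 by exact: coord_continuous.
exact: (cvgMl_tmp yi).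
Qed.

Lemma sqr_norm2 u : norm2 u ^+ 2 = dotp u u.
Proof.
rewrite /norm2 sqr_sqrtr ?dotpE; last by apply: sumr_ge0 => i _; exact: sqr_ge0.
by apply: eq_bigr => i _; rewrite expr2.
Qed.

Lemma dotp_gt0 u : u != 0 -> 0 < dotp u u.
Proof.
move=> u0; have dd : 0 <= dotp u u by rewrite -sqr_norm2 sqr_ge0.
rewrite lt_neqAle dd andbT eq_sym dotpE psumr_eq0; last first.
  by move=> i _; rewrite -expr2 sqr_ge0.
apply: contra u0 => /allP u0; apply/eqP/matrixP => i j.
have := u0 i; rewrite ord1 mxE mem_index_enum mulf_eq0 orbb.
by move=> /(_ isT)/eqP.
Qed.

(** The projection kills [u], since [u *m u^T *m u] is [u] scaled by its squared norm. *)
Lemma proj_orth_dir u k x : u != 0 ->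
  proj_orth u *m (x + k *: u) = proj_orth u *m x.
Proof.
move=> u0; rewrite mulmxDr -scalemxAr.
suff -> : proj_orth u *m u = 0 by rewrite scaler0 addr0.
rewrite /proj_orth mulmxBl mul1mx -scalemxAl -mulmxA [u^T *m u]mx11_scalar.
rewrite mul_mx_scalar scalerA sqr_norm2 mulVf ?scale1r ?subrr//.
by rewrite gt_eqF// dotp_gt0.
Qed.

(** The strict slab is open by continuity of [dotp u]. Conversely, an interior point can be moved a
    little both ways along [u], which changes [dotp u] strictly because [u != 0]. *)
Lemma split_set_interior u (u0 u1 : R) : u != 0 ->
  (split_set u u0 u1)° = [set p | u0 < dotp u p.1 < u1].
Proof.
move=> uN0; have d0 := dotp_gt0 _ uN0; apply/seteqP; split => -[x t] /=; last first.
  move=> xu; have oU : open [set p : 'cV[R]_n * R^o | u0 < dotp u p.1 < u1].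
    have cd : continuous (fun p : 'cV[R]_n * R^o => dotp u p.1).
      by move=> p; apply: continuous_comp; [exact: cvg_fst|exact: dotp_continuous].
    have oI : open [set r : R | u0 < r < u1].
      rewrite (_ : [set r | _] = [set r | u0 < r] `&` [set r | r < u1]).
        by apply: openI; [exact: open_gt|exact: open_lt].
      by apply/seteqP; split => r /= => [/andP[]|[-> ->]].
    exact: (open_comp (fun p _ => cd p) oI).
  have : [set p : 'cV[R]_n * R^o | u0 < dotp u p.1 < u1] `<=` split_set u u0 u1.
    by move=> p /= /andP[a b]; rewrite /split_set/= !ltW.
  by rewrite open_subsetE//; apply.
have ray : x + e *: u @[e --> (0 : R)] --> x.
  rewrite -[X in _ --> X]addr0 -(scale0r u); apply: cvgD; first exact: cvg_cst.
  by apply: cvgZr_tmp; exact: cvg_id.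
have c := cvg_pair ray (cvg_cst (t : R^o)).
move=> xF; have : \forall e \near (0 : R), split_set u u0 u1 (x + e *: u, t).
  exact: c xF.
move=> /nbhs_ballP[e /= e0 eF].
have F e' : `|e'| < e -> u0 <= dotp u x + e' * dotp u u <= u1.
  move=> he; have := eF e'.
  by rewrite /ball/= sub0r normrN /split_set/= dotpDr dotpZr; apply.
(* Half the radius stays inside the ball: the shift by [e / 2] makes the upper bound strict, the
   shift by [- (e / 2)] the lower one. *)
have he : `|e / 2| < e by rewrite ger0_norm; lra.
have /andP[_ A] := F _ he.
have /andP[B _] : u0 <= dotp u x + (- (e / 2)) * dotp u u <= u1.
  by apply: F; rewrite normrN.
by have : 0 < e / 2 * dotp u u by [rewrite mulr_gt0//; lra]; lra.
Qed.

End split.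

(** Both arguments, of [g] and of [f], are linear in the point, so the two convexity inequalities
    add up. This serves for [S], and for [C] with the secant in the role of [f]. *)
Lemma convex_split_epi {R : realType} {n : nat} (u : 'cV[R]_n)
    (g : 'cV[R]_n -> R) (f : R -> R) :
  convex_function [set: 'cV[R]_n] g -> convex_function [set: R^o] f ->
  convex_set (split_epi u g f).
Proof.
move=> /convex_functionP gc /convex_functionP fc.
apply/convex_setP => k [x s] [y t] /[dup] k01 /andP[k0 k1].
rewrite /split_epi/= => xs yt.
rewrite mulmxDr -!scalemxAr dotpDr !dotpZr.
have gk := gc k (proj_orth u *m x) (proj_orth u *m y) k01.
have fk := fc k (dotp u x) (dotp u y) k01.
rewrite -[(k *: (dotp u x : R^o) + _)]/(k * dotp u x + (1 - k) * dotp u y) in fk.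
apply: (le_trans (lerD gk fk)); rewrite addrACA -!mulrDr.
by rewrite lerD// ler_wpM2l// subr_ge0.
Qed.

Theorem proposition3p3 (R : realType) (n : nat) (pi : 'cV[R]_n)
    (pi0 pi1 : R) (g : 'cV[R]_n -> R) (f : R -> R)
    (pi_neq0 : pi != 0) (pi01 : pi0 < pi1)
    (g_convex : convex_function [set: 'cV[R]_n] g)
    (g_closed : closed_function g)
    (f_convex : convex_function [set: R^o] f)
    (f_closed : closed_function f) :
  let F := split_set pi pi0 pi1 in
  let S := split_epi pi g f in
  let a := (f pi1 - f pi0) / (pi1 - pi0) in
  let b := (pi1 * f pi0 - pi0 * f pi1) / (pi1 - pi0) in
  let C := split_cut pi g a b in
  convex_hull (S `\` F°) = S `&` C.
Proof.
move=> F S a b C.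
have d0 : 0 < pi1 - pi0 by rewrite subr_gt0.
have dN0 : pi1 - pi0 != 0 by rewrite gt_eqF.
have secantE s : a * s + b = ((pi1 - s) * f pi0 + (s - pi0) * f pi1) / (pi1 - pi0).
  by rewrite /a /b; field.
have S_convex : convex_set S by exact: convex_split_epi.
have CE : C = split_epi pi g (fun s => a * s + b).
  by apply/seteqP; split => p; rewrite /C /split_epi /split_cut/= addrA.
have C_convex : convex_set C.
  rewrite CE; apply: convex_split_epi => //; apply/convex_functionP => k s t _.
  by rewrite /GRing.scale/= le_eqVlt; apply/orP; left; apply/eqP; ring.
rewrite /F split_set_interior//.
apply/seteqP; split.
  apply: smallest_sub.
    move: S_convex C_convex; rewrite !convex_setP.
    move=> Sc Cc k p q k01 [Sp Cp] [Sq Cq].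
    by split; [exact: Sc|exact: Cc].
  move=> [x t] [Sx nF]; split => //; rewrite CE; apply: le_trans Sx => /=.
  move: nF => /=; set s := dotp pi x => nF.
  rewrite lerD2l secantE ler_pdivrMr//.
  (* The face nearer to [s] lies between [s] and the other face; convexity at that middle point puts
     the extended secant below [f] at [s]. *)
  have [s0|s0] := leP s pi0.
    by have := convex_three_points s pi0 pi1 f_convex ltac:(lra); lra.
  have s1 : pi1 <= s by rewrite leNgt; apply/negP => s1; apply: nF; rewrite s0.
  by have := convex_three_points pi0 pi1 s f_convex ltac:(lra); lra.
move=> [x t] [Sx Cx]; set A := (X in convex_hull X).
have [s01|s01] := boolP (pi0 < dotp pi x < pi1); last first.
  by apply: sub_gen_smallest; split => //=; apply/negP.
have [s0 s1] := andP s01; set s := dotp pi x in s0 s1 s01.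
have n0 := dotp_gt0 _ pi_neq0; have nN0 : dotp pi pi != 0 by rewrite gt_eqF.
(* For [r = pi0] and [r = pi1], [f r] is the secant value [a * r + b]. *)
pose face (r : R) : 'cV[R]_n * R^o :=
  (x + ((r - s) / dotp pi pi) *: pi, t - (a * s + b) + f r).
have faceA r : ~~ (pi0 < r < pi1) -> A (face r).
  move=> r01; have dr : dotp pi (face r).1 = r.
    by rewrite /= dotpDr dotpZr -/s; field.
  split; last by rewrite /= dr; exact/negP.
  (* The term [f r] cancels against the height of [face r], leaving the inequality that defines [C]
     at [(x, t)]. *)
  rewrite /S /split_epi/= dr proj_orth_dir//.
  by move: Cx; rewrite CE /split_epi/= -/s; lra.
move=> B [/convex_setP Bc AB].
(* Chosen so that [k * pi0 + (1 - k) * pi1 = s]: the shifts along [pi] then cancel, and the values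
   of [f] at the faces average to [a * s + b]. *)
pose k := (pi1 - s) / (pi1 - pi0).
have k01 : 0 <= k <= 1.
  by rewrite /k divr_ge0 ?ler_pdivrMr ?mul1r; lra.
have -> : (x, t) = k *: face pi0 + (1 - k) *: face pi1.
  congr pair => /=.
    rewrite !scalerDr addrACA -scalerDl subrKC scale1r !scalerA -scalerDl.
    have -> : k * ((pi0 - s) / dotp pi pi) +
        (1 - k) * ((pi1 - s) / dotp pi pi) = 0 by rewrite /k; field; apply/andP.
    by rewrite scale0r addr0.
  rewrite -[LHS]/(t : R) /GRing.scale/= secantE /k.
  by field.
by apply: Bc => //; apply/AB/faceA; rewrite ?ltxx ?andbF.
Qed.
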